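(* Let $A\in\mathbb R^{n\times n}$, $C\in\mathbb R^{m\times n}$, $Q\in\mathbb S^n_{++}$, $R\in\mathbb S^m_{++}$, $\lambda\in(0,1]$ with $\lambda>1-1/\rho(A)^2$, and $M\in\mathbb S^n_{++}$. For $Z\ge0$ let $\bar X_{cl}(Z)$ be the unique positive definite solution of $X=g_{\lambda,R+Z^{-1}}(X)$. Then the problem $$\min_{T,Z}\ \mathrm{tr}(TZ)\quad\text{s.t. } \bar X_{cl}(Z)\le M,\ C\bar X_{cl}(Z)C^{\top}+R\le T,\ Z\ge0$$ is equivalent to $$\min_{Z,X,S}\ f(X,Z)=\mathrm{tr}\big((CXC^{\top}+R)Z\big)\quad\text{s.t. }(X,Z,S)\in\mathcal S,$$ where $$\mathcal S=\Big\{(X,Z,S):\begin{bmatrix}X&I\\ I&S\end{bmatrix}\ge0,\ \begin{bmatrix}S&I\\ I&M\end{bmatrix}\ge0,\ \Psi(S,Z)\ge0,\ Z\ge0\Big\}$$ and $$\Psi(S,Z)=\begin{bmatrix} S&\sqrt\lambda SA&\sqrt{1-\lambda}SA&S&0\\ \sqrt\lambda A^{\top}S&S+C^{\top}R^{-1}C&0&0&C^{\top}R^{-1}\\ \sqrt{1-\lambda}A^{\top}S&0&S&0&0\\ S&0&0&Q^{-1}&0\\ 0&R^{-1}C&0&0&Z+R^{-1}\end{bmatrix}.$$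
   Context: For $X\ge0$, $W>0$, $\theta\in(0,1]$, $g_{\theta,W}(X)=AXA^{\top}+Q-\theta AXC^{\top}(CXC^{\top}+W)^{-1}CXA^{\top}$. Matrix inequalities are in the positive semidefinite order. Standing assumptions: $(A,\sqrt Q)$ stabilizable, $(A,C)$ detectable.
   Formalization: For singular Z≥0, where Z^{-1} is undefined, (CXC^T+R+Z^{-1})^{-1} is read as Z(I+(CXC^T+R)Z)^{-1}; where no unique positive definite solution exists (e.g. Z=0 with A unstable), (T,Z) counts as infeasible. Detectability is not assumed. *)

(* Defs.v *)
From HB Require Import structures.
From mathcomp Require Import all_boot all_order all_algebra.
From mathcomp Require Import complex.
From mathcomp Require Import boolp classical_sets reals.
Set Implicit Arguments. Unset Strict Implicit. Unset Printing Implicit Defensive.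
Import Order.TTheory GRing.Theory Num.Theory.
Local Open Scope ring_scope.
Local Open Scope classical_set_scope.

Section Defs.
Variable R : realType.

Definition symmx n (X : 'M[R]_n) : Prop := X^T = X.

Definition psd n (X : 'M[R]_n) : Prop :=
  symmx X /\ forall v : 'cV[R]_n, 0 <= (v^T *m X *m v) 0 0.

Definition posdef n (X : 'M[R]_n) : Prop :=
  symmx X /\ forall v : 'cV[R]_n, v != 0 -> 0 < (v^T *m X *m v) 0 0.

Definition psd_le n (X Y : 'M[R]_n) : Prop := symmx X /\ symmx Y /\ psd (Y - X).

Definition cmod (z : R[i]) : R := Num.sqrt (complex.Re z ^+ 2 + complex.Im z ^+ 2).

(* spectral radius of a real square matrix: the largest modulus of its
   (complex) eigenvalues; sup of the empty set is 0 (case n = 0). *)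
Definition spectral_radius n (A : 'M[R]_n) : R :=
  sup [set cmod mu | mu in
        [set mu : R[i] | eigenvalue (map_mx (real_complex R) A) mu]].

Definition g_map n m (A : 'M[R]_n) (C : 'M[R]_(m, n)) (Q : 'M[R]_n)
    (theta : R) (W : 'M[R]_m) (X : 'M[R]_n) : 'M[R]_n :=
  A *m X *m A^T + Q
  - theta *: (A *m X *m C^T *m invmx (C *m X *m C^T + W) *m C *m X *m A^T).

(* g_{lambda, Rm + Z^{-1}}(X), written so that it makes sense also for
   singular Z >= 0:  (P + Z^{-1})^{-1} = Z (I + P Z)^{-1}  with
   P = C X C^T + Rm.  For invertible Z this is exactly
   g_map A C Q lambda (Rm + invmx Z) X. *)
Definition g_clZ n m (A : 'M[R]_n) (C : 'M[R]_(m, n)) (Q : 'M[R]_n)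
    (Rm : 'M[R]_m) (lam : R) (Z : 'M[R]_m) (X : 'M[R]_n) : 'M[R]_n :=
  A *m X *m A^T + Q
  - lam *: (A *m X *m C^T
             *m (Z *m invmx (1%:M + (C *m X *m C^T + Rm) *m Z))
             *m C *m X *m A^T).

Definition is_Xcl n m (A : 'M[R]_n) (C : 'M[R]_(m, n)) (Q : 'M[R]_n)
    (Rm : 'M[R]_m) (lam : R) (Z : 'M[R]_m) (X : 'M[R]_n) : Prop :=
  posdef X /\ X = g_clZ A C Q Rm lam Z X /\
  (forall Y, posdef Y -> Y = g_clZ A C Q Rm lam Z Y -> Y = X).

Definition feasible_orig n m (A : 'M[R]_n) (C : 'M[R]_(m, n)) (Q : 'M[R]_n)
    (Rm : 'M[R]_m) (lam : R) (M : 'M[R]_n) (T Z : 'M[R]_m) : Prop :=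
  exists Xcl, is_Xcl A C Q Rm lam Z Xcl /\
    psd_le Xcl M /\ psd_le (C *m Xcl *m C^T + Rm) T /\ psd Z.

Definition Psi n m (A : 'M[R]_n) (C : 'M[R]_(m, n)) (Q : 'M[R]_n)
    (Rm : 'M[R]_m) (lam : R) (S : 'M[R]_n) (Z : 'M[R]_m)
    : 'M[R]_((n + n) + (n + n) + m) :=
  let sl := Num.sqrt lam in
  let sl' := Num.sqrt (1 - lam) in
  let Ri := invmx Rm in
  block_mx
    (block_mx
       (block_mx S (sl *: (S *m A)) (sl *: (A^T *m S)) (S + C^T *m Ri *m C))
       (block_mx (sl' *: (S *m A)) S 0 0)
       (block_mx (sl' *: (A^T *m S)) 0 S 0)
       (block_mx S 0 0 (invmx Q)))
    (col_mx (col_mx 0 (C^T *m Ri)) (col_mx 0 0))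
    (row_mx (row_mx 0 (Ri *m C)) (row_mx 0 0))
    (Z + Ri).

Definition in_calS n m (A : 'M[R]_n) (C : 'M[R]_(m, n)) (Q : 'M[R]_n)
    (Rm : 'M[R]_m) (lam : R) (M : 'M[R]_n)
    (X : 'M[R]_n) (Z : 'M[R]_m) (S : 'M[R]_n) : Prop :=
  psd (block_mx X 1%:M 1%:M S) /\
  psd (block_mx S 1%:M 1%:M M) /\
  psd (Psi A C Q Rm lam S Z) /\
  psd Z.

Definition f_obj n m (C : 'M[R]_(m, n)) (Rm : 'M[R]_m)
    (X : 'M[R]_n) (Z : 'M[R]_m) : R :=
  \tr ((C *m X *m C^T + Rm) *m Z).

End Defs.

(* Main.v *)
Require Import Defs.
From HB Require Import structures.
From mathcomp Require Import all_boot all_order all_algebra.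
From mathcomp Require Import complex.
From mathcomp Require Import boolp classical_sets reals.
From mathcomp Require Import topology normedtype sequences.
From mathcomp Require Import ring lra.
Import Order.TTheory GRing.Theory Num.Theory.
Set Implicit Arguments. Unset Strict Implicit. Unset Printing Implicit Defensive.
Local Open Scope ring_scope.

(* Write [N = (R + Z^-1)^-1], [H = C^T N C]. For positive definite [X] Woodbury's
   identity turns the closed-loop map into
     g(X) = (1 - lam) A X A^T + Q + lam A (X^-1 + H)^-1 A^T,
   which is monotone and, for [t >= 1], satisfies g(tX) <= t g(X) - (t - 1) Q.
   Since [Q > 0], this strict subhomogeneity makes the positive definite fixed
   point unique, and also shows that the decreasing iteration of [g] started at
   a [Y] with [g(Y) <= Y] converges to a fixed point below [Y].
   Three Schur complements show that [Psi(S, Z) >= 0] says exactly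
   [g(S^-1) <= S^-1]; so [S^-1] bounds the fixed point from above, and
   conversely the inverse of the fixed point is an admissible [S]. *)

(** * Quadratic forms and polarization *)

Definition qform (R : realType) n (X : 'M[R]_n) (v : 'cV[R]_n) : R :=
  (v^T *m X *m v) 0 0.

Lemma qformD (R : realType) n (X Y : 'M[R]_n) v :
  qform (X + Y) v = qform X v + qform Y v.
Proof. by rewrite /qform mulmxDr mulmxDl mxE. Qed.

Lemma qformZ (R : realType) n a (X : 'M[R]_n) v :
  qform (a *: X) v = a * qform X v.
Proof. by rewrite /qform -scalemxAr -scalemxAl mxE. Qed.

Lemma qformN (R : realType) n (X : 'M[R]_n) v : qform (- X) v = - qform X v.
Proof. by rewrite -scaleN1r qformZ mulN1r. Qed.

Lemma qformB (R : realType) n (X Y : 'M[R]_n) v :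
  qform (X - Y) v = qform X v - qform Y v.
Proof. by rewrite qformD qformN. Qed.

Lemma qform_congr (R : realType) n p (B : 'M[R]_(p, n)) (X : 'M[R]_n) v :
  qform (B *m X *m B^T) v = qform X (B^T *m v).
Proof. by rewrite /qform trmx_mul trmxK !mulmxA. Qed.

Lemma qform_sum (R : realType) n (X : 'M[R]_n) v :
  qform X v = \sum_i \sum_j X i j * (v i 0 * v j 0).
Proof.
rewrite /qform mxE exchange_big /=; apply: eq_bigr => j _.
rewrite mxE big_distrl /=; apply: eq_bigr => i _.
by rewrite !mxE; ring.
Qed.

Lemma qform1 (R : realType) n (v : 'cV[R]_n) :
  qform 1%:M v = \sum_i v i 0 ^+ 2.
Proof.
by rewrite /qform mulmx1 mxE; apply: eq_bigr => i _; rewrite mxE expr2.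
Qed.

Lemma qform0r (R : realType) n (X : 'M[R]_n) : qform X 0 = 0.
Proof. by rewrite /qform mulmx0 mxE. Qed.

Lemma bilin_delta (R : realType) n (X : 'M[R]_n) (i j : 'I_n) :
  (delta_mx i 0 : 'cV[R]_n)^T *m X *m delta_mx j 0 = (X i j)%:M.
Proof.
rewrite trmx_delta -rowE -colE.
by apply/matrixP => a b; rewrite !mxE !ord1 eqxx.
Qed.

Lemma qform_delta (R : realType) n (X : 'M[R]_n) (i : 'I_n) :
  qform X (delta_mx i 0) = X i i.
Proof. by rewrite /qform bilin_delta mxE eqxx. Qed.

(** Recovers entries from values of the form, so that equalities and limits of symmetric matrices
    reduce to scalar ones. *)
Lemma qform_polar (R : realType) n (X : 'M[R]_n) (i j : 'I_n) : symmx X ->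
  X i j = (qform X (delta_mx i 0 + delta_mx j 0)
           - qform X (delta_mx i 0) - qform X (delta_mx j 0)) / 2.
Proof.
move=> sX; have sij : X j i = X i j by rewrite -[in LHS]sX mxE.
rewrite /qform [(_ + _)^T]linearD /= !(mulmxDl, mulmxDr) !bilin_delta.
by rewrite !mxE !eqxx /= !mulr1n sij; field.
Qed.

(** * Elementary properties of semidefinite and definite matrices *)

Lemma psd0 (R : realType) n : psd (0 : 'M[R]_n).
Proof.
by split=> [|v]; [exact: trmx0 | rewrite mulmx0 mul0mx mxE].
Qed.

Lemma psdD (R : realType) n (X Y : 'M[R]_n) : psd X -> psd Y -> psd (X + Y).
Proof.
move=> [sX pX] [sY pY]; split; first by rewrite /symmx linearD /= sX sY.
by move=> v; rewrite -/(qform _ _) qformD addr_ge0 //; [exact: pX|exact: pY].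
Qed.

Lemma psdZ (R : realType) n a (X : 'M[R]_n) : 0 <= a -> psd X -> psd (a *: X).
Proof.
move=> a0 [sX pX]; split; first by rewrite /symmx linearZ /= sX.
by move=> v; rewrite -/(qform _ _) qformZ mulr_ge0 //; exact: pX.
Qed.

Lemma psd_congr (R : realType) n p (B : 'M[R]_(p, n)) (X : 'M[R]_n) :
  psd X -> psd (B *m X *m B^T).
Proof.
move=> [sX pX]; split; first by rewrite /symmx !trmx_mul trmxK sX mulmxA.
by move=> v; rewrite -/(qform _ _) qform_congr; exact: pX.
Qed.

Lemma posdef_psd (R : realType) n (X : 'M[R]_n) : posdef X -> psd X.
Proof.
move=> [sX pX]; split=> // v; have [->|v0] := eqVneq v 0.
  by rewrite mulmx0 mxE.
exact/ltW/pX.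
Qed.

Lemma posdefD_psd (R : realType) n (X Y : 'M[R]_n) :
  posdef X -> psd Y -> posdef (X + Y).
Proof.
move=> [sX pX] [sY pY]; split; first by rewrite /symmx linearD /= sX sY.
move=> v v0; rewrite -/(qform _ _) qformD ltr_pwDl //; first exact: pX.
exact: pY.
Qed.

Lemma posdef_le (R : realType) n (X Y : 'M[R]_n) :
  posdef X -> psd (Y - X) -> posdef Y.
Proof. by move=> pX /(posdefD_psd pX); rewrite addrC subrK. Qed.

Lemma posdefZ (R : realType) n a (X : 'M[R]_n) :
  0 < a -> posdef X -> posdef (a *: X).
Proof.
move=> a0 [sX pX]; split; first by rewrite /symmx linearZ /= sX.
by move=> v v0; rewrite -/(qform _ _) qformZ mulr_gt0 //; exact: pX.
Qed.

Lemma psd_le_trans (R : realType) n (X Y W : 'M[R]_n) :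
  psd (Y - X) -> psd (W - Y) -> psd (W - X).
Proof. by move=> h1 h2; have := psdD h2 h1; rewrite addrA subrK. Qed.

Lemma psd_le_anti (R : realType) n (X Y : 'M[R]_n) :
  psd (Y - X) -> psd (X - Y) -> X = Y.
Proof.
move=> [sD pD] [_ pN]; apply/esym/eqP; rewrite -subr_eq0; apply/eqP.
set D := Y - X in sD pD *.
have q0 v : qform D v = 0.
  apply/eqP; rewrite eq_le; apply/andP; split; last exact: pD.
  have := pN v; rewrite -/(qform _ _) -opprB -/D qformN; lra.
by apply/matrixP => i j; rewrite (qform_polar i j sD) !q0 !subrr mul0r mxE.
Qed.

Lemma posdef_unit (R : realType) n (X : 'M[R]_n) : posdef X -> X \in unitmx.
Proof.
move=> [sX pX]; rewrite -row_free_unit -kermx_eq0; apply/rowV0P => v.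
move/sub_kermxP => vX; apply/eqP; apply: contraT => v0.
by have := pX v^T; rewrite trmxK vX mul0mx mxE ltxx trmx_eq0 => /(_ v0).
Qed.

Lemma posdef_inv (R : realType) n (X : 'M[R]_n) : posdef X -> posdef (invmx X).
Proof.
move=> pdX; have uX := posdef_unit pdX; have [sX pX] := pdX.
have sI : (invmx X)^T = invmx X by rewrite trmx_inv sX.
split=> // v v0.
(* The form of [X^-1] at [v] is the form of [X] at [X^-1 v], which is nonzero. *)
rewrite -[X in v^T *m X *m v]mul1mx -(mulVmx uX) -{2}sI.
rewrite -/(qform _ _) qform_congr; apply: pX; apply: contra v0 => /eqP h.
by rewrite -(mul1mx v) -(mulmxV uX) -{1}sI -mulmxA h mulmx0.
Qed.

(** * Congruence, Schur complements and antitonicity of the inverse *)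

Lemma psd_congr_iff (R : realType) n (B X : 'M[R]_n) :
  B \in unitmx -> psd (B *m X *m B^T) <-> psd X.
Proof.
move=> uB; split; last exact: psd_congr.
move/(psd_congr (invmx B)); rewrite trmx_inv -!mulmxA mulmxV ?unitmx_tr //.
by rewrite mulmx1 mulKmx.
Qed.

Lemma psd_block_diag (R : realType) n p (X : 'M[R]_n) (D : 'M[R]_p) :
  psd D -> psd (block_mx X 0 0 D) <-> psd X.
Proof.
move=> [sD pD].
have q (x : 'cV_n) (y : 'cV_p) :
    qform (block_mx X 0 0 D) (col_mx x y) = qform X x + qform D y.
  rewrite /qform tr_col_mx mul_row_block mul_row_col !mulmx0 addr0 add0r.
  by rewrite mxE.
split=> -[sX pX].
  split=> [|v].
    by move: sX; rewrite /symmx tr_block_mx => /eq_block_mx[].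
  by have := pX (col_mx v 0); rewrite -/(qform _ _) q qform0r addr0.
split=> [|v]; first by rewrite /symmx tr_block_mx sX sD !trmx0.
by rewrite -[v]vsubmxK -/(qform _ _) q addr_ge0 //; [exact: pX|exact: pD].
Qed.

(** Block elimination: a unipotent congruence [L] carries the diagonal of [D] and its Schur
    complement to the block matrix. *)
Lemma psd_schur (R : realType) n p (X : 'M[R]_n) (B : 'M[R]_(n, p))
    (D : 'M[R]_p) : posdef D ->
  psd (block_mx X B B^T D) <-> psd (X - B *m invmx D *m B^T).
Proof.
move=> pdD; have uD := posdef_unit pdD.
have sI : (invmx D)^T = invmx D by case: (posdef_inv pdD).
set L : 'M_(n + p) := block_mx 1%:M (B *m invmx D) 0 1%:M.
have uL : L \in unitmx by rewrite unitmxE det_ublock !det1 mulr1 unitr1.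
suff -> : block_mx X B B^T D =
    L *m block_mx (X - B *m invmx D *m B^T) 0 0 D *m L^T.
  exact: iff_trans (psd_congr_iff _ uL) (psd_block_diag _ (posdef_psd pdD)).
rewrite /L tr_block_mx !mulmx_block trmx_mul sI !trmx0 !trmx1.
rewrite !(mul0mx, mulmx0, mul1mx, mulmx1, addr0, add0r).
by rewrite mulmxKV // mulmxA subrK mulKVmx.
Qed.

(** Up to a swap of blocks, [Y - X] and [X^-1 - Y^-1] are the two Schur complements of one matrix
    with diagonal [Y], [X^-1] and identities off it. *)
Lemma psd_inv_anti (R : realType) n (X Y : 'M[R]_n) :
  posdef X -> psd (Y - X) -> psd (invmx X - invmx Y).
Proof.
move=> pX h; have pY := posdef_le pX h.
have := psd_schur Y 1%:M (posdef_inv pX).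
rewrite trmx1 mul1mx mulmx1 invmxK => -[_ /(_ h)] H.
have := psd_schur (invmx X) 1%:M pY.
rewrite trmx1 mul1mx mulmx1 => -[+ _]; apply.
have := psd_congr (block_mx 0 1%:M 1%:M 0) H.
rewrite tr_block_mx !mulmx_block !trmx0 !trmx1.
by rewrite !(mul0mx, mulmx0, mul1mx, mulmx1, addr0, add0r).
Qed.

(* Cauchy-Schwarz in the form [v_i^2 <= (X^-1)_ii (v^T X v)]. *)
Lemma psd_scalar_le (R : realType) n (X : 'M[R]_n) :
  posdef X -> psd (\tr (invmx X) *: X - 1%:M).
Proof.
move=> pX; have [sX qX] := posdef_psd pX.
split=> [|v]; first by rewrite /symmx linearB /= linearZ /= sX trmx1.
rewrite -/(qform _ _) qformB qformZ qform1 subr_ge0 /mxtrace big_distrl /=.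
apply: ler_sum => i _.
have uX := posdef_unit pX.
have sI : (invmx X)^T = invmx X by case: (posdef_inv pX).
set e : 'cV[R]_n := delta_mx i 0.
have ve : (v^T *m e) 0 0 = v i 0 by rewrite -colE !mxE.
have ev : (e^T *m v) 0 0 = v i 0 by rewrite trmx_delta -rowE !mxE.
have ee : (e^T *m invmx X *m e) 0 0 = invmx X i i.
  by rewrite bilin_delta mxE eqxx.
set d : R := invmx X i i.
have d0 : 0 < d.
  rewrite /d -ee; have [_] := posdef_inv pX; apply.
  by apply/eqP => /matrixP/(_ i 0)/eqP; rewrite !mxE !eqxx oner_eq0.
(* At this test vector the form of [X] equals [d (d q - w^2)], with [q] the form at [v] and
   [w = v_i]. *)
have := qX (d *: v - v i 0 *: (invmx X *m e)).
rewrite [(_ - _)^T]linearB /= ![(_ *: _)^T]linearZ /= trmx_mul sI.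
rewrite !(mulmxBl, mulmxBr) -!(scalemxAl, scalemxAr) !mulmxA.
rewrite !(mulmxK, mulmxKV) //.
rewrite !mxE -/(qform X v).
move: ve ev ee; rewrite !mxE => -> -> ->; rewrite -/d.
set q := qform X v; set w : R := v i 0 => h.
have qE : \sum_j (v^T *m X) 0 j * v j 0 = q by rewrite /q /qform mxE.
rewrite qE in h.
have : 0 <= d * (d * q - w ^+ 2).
  by apply: le_trans h _; rewrite le_eqVlt; apply/orP; left; apply/eqP; ring.
by rewrite pmulr_rge0 // subr_ge0 mulrC.
Qed.

(** * Norm, domination and trace bounds *)

(** This norm bounds the quadratic form and visibly tends to zero under entrywise convergence. *)
Definition entry_norm (R : realType) n (X : 'M[R]_n) : R :=
  \sum_i \sum_j `|X i j|.

Lemma entry_norm_ge0 (R : realType) n (X : 'M[R]_n) : 0 <= entry_norm X.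
Proof. by do 2 (apply: sumr_ge0 => ? _). Qed.

Lemma qform_le_entry_norm (R : realType) n (X : 'M[R]_n) v :
  `|qform X v| <= entry_norm X * qform 1%:M v.
Proof.
have sq i : v i 0 ^+ 2 <= qform 1%:M v.
  rewrite qform1 (bigD1 i) //= lerDl; apply: sumr_ge0 => j _.
  exact: sqr_ge0.
rewrite qform_sum /entry_norm big_distrl /=.
apply: (le_trans (ler_norm_sum _ _ _)); apply: ler_sum => i _.
rewrite big_distrl /=.
apply: (le_trans (ler_norm_sum _ _ _)); apply: ler_sum => j _.
rewrite normrM; apply: ler_wpM2l => //.
have := sq i; have := sq j; move: (v i 0) (v j 0) => x y hy hx.
by rewrite ler_norml; apply/andP; split; nra.
Qed.

Lemma psd_entry_norm_le (R : realType) n (X : 'M[R]_n) :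
  symmx X -> psd (entry_norm X *: 1%:M - X).
Proof.
move=> sX; split=> [|v]; first by rewrite /symmx linearB /= linearZ /= sX trmx1.
rewrite -/(qform _ _) qformB qformZ subr_ge0.
exact: le_trans (ler_norm _) (qform_le_entry_norm _ _).
Qed.

Lemma psd_trace_ge0 (R : realType) n (X : 'M[R]_n) : psd X -> 0 <= \tr X.
Proof.
move=> [_ pX]; apply: sumr_ge0 => i _; rewrite -qform_delta; exact: pX.
Qed.

Lemma psd_dominated (R : realType) n (X Y : 'M[R]_n) :
  posdef X -> symmx Y -> exists2 c, 1 < c & psd (c *: X - Y).
Proof.
move=> pX sY.
have t0 := psd_trace_ge0 (posdef_psd (posdef_inv pX)).
have s0 := entry_norm_ge0 Y.
(* The chain is [Y <= |Y| I <= |Y| tr(X^-1) X]; the added 2 forces [1 < c]. *)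
exists (entry_norm Y * \tr (invmx X) + 2); first by have := mulr_ge0 s0 t0; lra.
apply: psd_le_trans (psd_entry_norm_le sY) _.
have -> : (entry_norm Y * \tr (invmx X) + 2) *: X - entry_norm Y *: 1%:M =
  entry_norm Y *: (\tr (invmx X) *: X - 1%:M) + 2 *: X.
  by rewrite scalerBr scalerA scalerDl addrAC.
apply: psdD; apply: psdZ => //; [exact: psd_scalar_le|exact: posdef_psd].
Qed.

(* Induction peels off the rank-one term [z z^T / a] of the Cholesky
   factorisation of [Z], with [z] its first column and [a] its first entry. *)
Lemma psd_trace_mul_ge0 (R : realType) n (P Z : 'M[R]_n) :
  psd P -> psd Z -> 0 <= \tr (P *m Z).
Proof.
elim: n P Z => [|n IH] P Z pP pZ; first by rewrite /mxtrace big_ord0.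
rewrite -[n.+1]/(1 + n)%N in P Z pP pZ *.
have sub (X : 'M[R]_(1 + n)) : psd X -> psd (drsubmx X).
  move=> [sX qX]; split=> [|v]; first by rewrite /symmx trmx_drsub sX.
  have := qX (col_mx 0 v); rewrite -{1}[X]submxK tr_col_mx trmx0.
  by rewrite mul_row_block mul_row_col !mul0mx mulmx0 !add0r.
(* When the first row of [D] vanishes, only the lower right blocks contribute to the trace, and
   induction applies. *)
have red (D : 'M[R]_(1 + n)) :
    psd D -> (forall j, D 0 j = 0) -> 0 <= \tr (P *m D).
  move=> pD r0; have [sD _] := pD.
  have -> : D = block_mx 0 0 0 (drsubmx D).
    rewrite -{1}[D]submxK; congr block_mx; apply/matrixP => i j; rewrite !mxE.
    - by rewrite !ord1 lshift0 r0.
    - by rewrite !ord1 lshift0 r0.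
    - by rewrite ord1 -[in LHS]sD mxE lshift0 r0.
  rewrite -[P]submxK mulmx_block !mulmx0 !addr0 !add0r mxtrace_block mxtrace0.
  by rewrite add0r; apply: IH; exact: sub.
have [sZ qZ] := pZ.
set a := Z 0 0.
have a0 : 0 <= a by rewrite /a -qform_delta; exact: qZ.
have [a_eq|a_neq] := eqVneq a 0.
  have z0 j : Z 0 j = 0.
    apply/eqP/negPn/negP => zj.
    (* With a zero corner entry the form is affine in [t]; a nonzero slope would let it reach -1. *)
    pose v t : 'cV[R]_(1 + n) := t *: delta_mx 0 0 + delta_mx j 0.
    have qv t : qform Z (v t) = 2 * t * Z 0 j + Z j j.
      have sij : Z j 0 = Z 0 j by rewrite -[in LHS]sZ mxE.
      rewrite /qform /v [(_ + _)^T]linearD /= [(_ *: _)^T]linearZ /=.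
      rewrite !(mulmxDl, mulmxDr) -!(scalemxAl, scalemxAr) !bilin_delta.
      by rewrite -/a a_eq !mxE !eqxx /= !mulr1n sij; ring.
    have := qZ (v (- (Z j j + 1) / 2 / Z 0 j)); rewrite -/(qform _ _) qv.
    have -> : 2 * (- (Z j j + 1) / 2 / Z 0 j) * Z 0 j + Z j j = -1 by field.
    lra.
  exact: red.
have ap : 0 < a by rewrite lt_def a_neq a0.
set z := col 0 Z.
have sD : psd (Z - a^-1 *: (z *m z^T)).
  have zE : z = Z *m delta_mx 0 0 by rewrite -colE.
  split=> [|v].
    by rewrite /symmx linearB /= linearZ /= trmx_mul trmxK sZ.
  (* Subtracting this multiple of the first basis vector completes the square: the form of [Z] there
     is the form of the remainder at [v]. *)
  have := qZ (v - ((z^T *m v) 0 0 / a) *: delta_mx 0 0).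
  rewrite -/(qform _ v) qformB qformZ.
  have -> : qform (z *m z^T) v = ((z^T *m v) 0 0) ^+ 2.
    rewrite /qform !mulmxA -mulmxA mxE big_ord1.
    have -> : v^T *m z = (z^T *m v)^T by rewrite trmx_mul trmxK.
    by rewrite mxE expr2.
  rewrite [(_ - _)^T]linearB /= [(_ *: _)^T]linearZ /=.
  rewrite !(mulmxBl, mulmxBr) -!(scalemxAl, scalemxAr) bilin_delta -/a.
  have -> : v^T *m Z *m delta_mx 0 0 = (z^T *m v)^T.
    by rewrite -mulmxA -zE trmx_mul trmxK.
  have -> : (delta_mx 0 0 : 'cV[R]_(1 + n))^T *m Z *m v = z^T *m v.
    by rewrite zE trmx_mul sZ.
  set w := z^T *m v; rewrite !mxE -/w -/(qform Z v) => h.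
  apply: (le_trans h); rewrite le_eqVlt; apply/orP; left; apply/eqP.
have -> : \sum_j (v^T *m Z) 0 j * v j 0 = qform Z v by rewrite /qform mxE.
  by rewrite eqxx mulr1n; field.
have -> : Z = a^-1 *: (z *m z^T) + (Z - a^-1 *: (z *m z^T)) by rewrite addrC subrK.
rewrite mulmxDr linearD /= addr_ge0 //.
  rewrite -scalemxAr linearZ /= mulr_ge0 ?invr_ge0 // mulmxA mxtrace_mulC mulmxA.
  by rewrite /mxtrace big_ord1; case: pP => _; exact.
set D := Z - _ in sD *.
apply: red => // j; rewrite !mxE big_ord1 !mxE -/a.
have -> : Z j 0 = Z 0 j by rewrite -[in LHS]sZ mxE.
by rewrite mulrA mulVf // mul1r subrr.
Qed.

(** * Closedness of the semidefinite cone and monotone limits *)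

Lemma posdef_symm (R : realType) n (X : 'M[R]_n) : posdef X -> symmx X.
Proof. by case. Qed.

Lemma posdef1 (R : realType) n : posdef (1%:M : 'M[R]_n).
Proof.
split=> [|v v0]; first exact: trmx1.
rewrite -/(qform _ _) qform1 lt_def; apply/andP; split; last first.
  by apply: sumr_ge0 => i _; exact: sqr_ge0.
apply: contra v0 => /eqP h; apply/eqP/matrixP => i j; rewrite ord1 mxE.
have /eqP := psumr_eq0P (fun i _ => sqr_ge0 (v i 0)) h (i := i) isT.
by rewrite sqrf_eq0 => /eqP.
Qed.

(** Let [e] tend to 0 in each quadratic form. The direction [E] is left free, since fixed-point
    arguments perturb by the identity and by [g L]. *)
Lemma psd_closed (R : realType) n (D E : 'M[R]_n) :
  symmx D -> (forall e, 0 < e -> psd (D + e *: E)) -> psd D.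
Proof.
move=> sD h; split=> // v; rewrite -/(qform _ _); apply/ler_addgt0Pr => e e0.
have c0 : 0 < `|qform E v| + 1 by rewrite ltr_wpDl.
have [_ /(_ v)] := h _ (divr_gt0 e0 c0).
rewrite -/(qform _ _) qformD qformZ => /le_trans; apply; rewrite lerD2l.
rewrite -mulrA ler_piMr ?ltW // mulrC ltr_pdivrMr // mul1r.
by rewrite (le_lt_trans (ler_norm _)) // ltrDl.
Qed.

Lemma posdef_block_diag (R : realType) n p (X : 'M[R]_n) (D : 'M[R]_p) :
  posdef X -> posdef D -> posdef (block_mx X 0 0 D).
Proof.
move=> [sX pX] [sD pD]; split; first by rewrite /symmx tr_block_mx sX sD !trmx0.
move=> v; rewrite -[v]vsubmxK; move: (usubmx v) (dsubmx v) => x y.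
rewrite tr_col_mx mul_row_block mul_row_col !mulmx0 addr0 add0r mxE.
have [->|x0] := eqVneq x 0; last first.
  by move=> _; apply: ltr_pwDl; [exact: pX | case: (posdef_psd (conj sD pD))].
have [->|y0] := eqVneq y 0; first by rewrite col_mx0 eqxx.
by move=> _; rewrite mulmx0 mxE add0r; exact: pD.
Qed.

Section limits.
Import numFieldNormedType.Exports.
Local Open Scope classical_set_scope.

(** Each quadratic form is nonincreasing and bounded below by 0, so it converges, and polarization
    turns the limits into the entries of [L]. Convergence is then restated in the semidefinite
    order. *)
Lemma psd_nonincreasing_limit (R : realType) n (x : nat -> 'M[R]_n) :
  (forall k, psd (x k)) -> (forall k, psd (x k - x k.+1)) ->
  exists2 L : 'M[R]_n, (forall k, psd (x k - L)) &
    forall e, 0 < e -> exists k, psd (L + e *: 1%:M - x k).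
Proof.
move=> px dx.
have sx k : symmx (x k) by case: (px k).
have mono v : {homo (fun k => qform (x k) v) : a b / (a <= b)%N >-> b <= a}.
  apply: homo_leq => [a|b a c ba cb|k] //; first exact: le_trans cb ba.
  by case: (dx k) => _ /(_ v); rewrite -/(qform _ _) qformB subr_ge0.
have qcvg v : cvgn (fun k => qform (x k) v).
  apply: nonincreasing_is_cvgn; first exact: mono.
  by exists 0 => _ [k _ <-]; case: (px k) => _; exact.
pose l v := limn (fun k => qform (x k) v).
pose L : 'M[R]_n := \matrix_(i, j)
  ((l (delta_mx i 0 + delta_mx j 0) - l (delta_mx i 0) - l (delta_mx j 0)) / 2).
have sL : symmx L.
  by apply/matrixP => i j; rewrite !mxE [delta_mx j 0 + _]addrC addrAC.
have xL i j : (fun k => x k i j) @ \oo --> L i j.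
  rewrite mxE.
  under eq_fun do rewrite (qform_polar i j (sx _)).
  by apply: cvgMr_tmp; apply: cvgB; [apply: cvgB|]; exact: qcvg.
have nL : (fun k => entry_norm (x k - L)) @ \oo --> (0 : R).
  have -> : (0 : R) = \sum_(i < n) \sum_(j < n) 0.
    by rewrite big1 // => i _; rewrite big1.
  apply: cvg_big => [|i _]; first exact: add_continuous.
  apply: cvg_big => [|j _]; first exact: add_continuous.
  have xE k : (x k - L) i j = x k i j - L i j by rewrite !mxE.
  under eq_fun do rewrite xE.
  have : `|x k i j - L i j| @[k --> \oo] --> `|L i j - L i j|.
    by apply: cvg_norm; apply: cvgB (xL i j) _; exact: cvg_cst.
  by rewrite subrr normr0.
have small e : 0 < e -> exists N, forall k, (N <= k)%N -> entry_norm (x k - L) <= e.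
  move=> e0; have /cvgrPdist_le/(_ e e0)[N _ hN] := nL.
  exists N => k /hN /=; rewrite sub0r normrN ger0_norm //; exact: entry_norm_ge0.
have sxL k : symmx (x k - L) by rewrite /symmx linearB /= sx sL.
have near k e : entry_norm (x k - L) <= e ->
    psd (e *: 1%:M - (x k - L)) /\ psd (x k - L + e *: 1%:M).
  move=> hk; have dom (D : 'M[R]_n) : symmx D -> entry_norm D <= e ->
      psd (e *: 1%:M - D).
    move=> sD hD; apply: psd_le_trans (psd_entry_norm_le sD) _.
    rewrite -scalerBl; apply: psdZ; first by rewrite subr_ge0.
    exact: posdef_psd (posdef1 R n).
  split; first exact: dom.
  rewrite addrC -[x k - L]opprK; apply: dom; first by rewrite /symmx linearN /= sxL.
  apply: le_trans hk; rewrite le_eqVlt; apply/orP; left; apply/eqP.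
  by apply: eq_bigr => i _; apply: eq_bigr => j _; rewrite mxE normrN.
have xmono k d : psd (x k - x (d + k)%N).
  elim: d => [|d IH]; first by rewrite subrr; exact: psd0.
  exact: psd_le_trans (dx _) IH.
exists L => [k|e e0].
  (* Pass through a late term: [x_k >= x_(N+k) >= L - e I]. *)
  apply: (@psd_closed _ _ _ 1%:M) => // e /small[N /(_ (N + k)%N (leq_addr _ _))].
  move=> /near[_ h]; have := psdD (xmono k N) h.
  by rewrite !addrA subrK.
have [N /(_ N (leqnn _))/near[h _]] := small _ e0.
by exists N; rewrite [L + _]addrC -addrA -[L - _]opprB.
Qed.

(** * The Riccati map: monotonicity, subhomogeneity and fixed points *)

(** The error covariance after a measurement update in information form: the information [H] is
    added to [X^-1]. *)
Definition mse (R : realType) n (H X : 'M[R]_n) := invmx (invmx X + H).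

Definition riccati (R : realType) n (A Q H : 'M[R]_n) (lam : R) (X : 'M[R]_n) :=
  (1 - lam) *: (A *m X *m A^T) + Q + lam *: (A *m mse H X *m A^T).

Lemma mse_posdef (R : realType) n (H X : 'M[R]_n) :
  psd H -> posdef X -> posdef (mse H X).
Proof. by move=> pH /posdef_inv pX; apply/posdef_inv/posdefD_psd. Qed.

Lemma mse_mono (R : realType) n (H X Y : 'M[R]_n) :
  psd H -> posdef X -> psd (Y - X) -> psd (mse H Y - mse H X).
Proof.
move=> pH pX h; have pY := posdef_le pX h.
apply: psd_inv_anti; first exact/posdefD_psd/pH/posdef_inv.
by rewrite opprD addrACA subrr addr0; exact: psd_inv_anti.
Qed.

(** Both sides are inverses, of [t^-1 X^-1 + t^-1 H] and [t^-1 X^-1 + H]; the first is smaller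
    because [t >= 1]. *)
Lemma mse_subhom (R : realType) n (H X : 'M[R]_n) t :
  psd H -> posdef X -> 1 <= t -> psd (t *: mse H X - mse H (t *: X)).
Proof.
move=> pH pX t1; have t0 : 0 < t by apply: lt_le_trans t1.
have pS : posdef (invmx X + H) by exact/posdefD_psd/pH/posdef_inv.
have pT : posdef (t^-1 *: (invmx X + H)) by apply: posdefZ; rewrite ?invr_gt0.
have -> : t *: mse H X = invmx (t^-1 *: (invmx X + H)).
  by rewrite invmxZ ?posdef_unit // invrK.
rewrite /mse (invmxZ (posdef_unit (posdefZ t0 pX))).
apply: psd_inv_anti => //.
rewrite scalerDr opprD addrACA subrr add0r -{1}[H]scale1r -scalerBl.
apply: psdZ => //.
by rewrite subr_ge0 invf_le1.
Qed.

Lemma riccati_mono (R : realType) n (A Q H : 'M[R]_n) lam X Y :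
  0 <= lam -> lam <= 1 -> psd H -> posdef X -> psd (Y - X) ->
  psd (riccati A Q H lam Y - riccati A Q H lam X).
Proof.
move=> l0 l1 pH pX h.
have -> : riccati A Q H lam Y - riccati A Q H lam X =
  (1 - lam) *: (A *m (Y - X) *m A^T) +
  lam *: (A *m (mse H Y - mse H X) *m A^T).
  rewrite /riccati !(mulmxBr, mulmxBl) !scalerBr.
  by apply/matrixP => i j; rewrite !mxE; ring.
apply: psdD; apply: psdZ; rewrite ?subr_ge0 //; apply: psd_congr => //.
exact: mse_mono.
Qed.

Lemma riccati_ge (R : realType) n (A Q H : 'M[R]_n) lam X :
  0 <= lam -> lam <= 1 -> psd H -> posdef X ->
  psd (riccati A Q H lam X - Q).
Proof.
move=> l0 l1 pH pX; rewrite /riccati addrAC addrK.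
apply: psdD; apply: psdZ; rewrite ?subr_ge0 //; apply/psd_congr/posdef_psd => //.
exact: mse_posdef.
Qed.

Lemma riccati_posdef (R : realType) n (A Q H : 'M[R]_n) lam X :
  0 <= lam -> lam <= 1 -> psd H -> posdef Q -> posdef X ->
  posdef (riccati A Q H lam X).
Proof. by move=> l0 l1 pH pQ pX; apply: posdef_le pQ _; exact: riccati_ge. Qed.

(** The term in [A X A^T] scales exactly and the constant [Q] accounts for [(t - 1) Q], so only the
    defect of [mse] remains. *)
Lemma riccati_subhom (R : realType) n (A Q H : 'M[R]_n) lam X t :
  0 <= lam -> psd H -> posdef X -> 1 <= t ->
  psd (t *: riccati A Q H lam X - (t - 1) *: Q - riccati A Q H lam (t *: X)).
Proof.
move=> l0 pH pX t1.
have -> : t *: riccati A Q H lam X - (t - 1) *: Q - riccati A Q H lam (t *: X) =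
  lam *: (A *m (t *: mse H X - mse H (t *: X)) *m A^T).
  rewrite /riccati !(mulmxBr, mulmxBl) -!(scalemxAl, scalemxAr).
  by apply/matrixP => i j; rewrite !mxE; ring.
by apply: psdZ => //; apply: psd_congr; exact: mse_subhom.
Qed.

(* Comparing two fixed points, the excess of the ratio [X <= (1 + e) Y] shrinks
   by the factor [1 - d] at each application of the map, where [d Y <= Q]. *)
Lemma riccati_fix_le (R : realType) n (A Q H : 'M[R]_n) lam X Y :
  0 <= lam -> lam <= 1 -> psd H -> posdef Q -> posdef X -> posdef Y ->
  X = riccati A Q H lam X -> Y = riccati A Q H lam Y -> psd (Y - X).
Proof.
move=> l0 l1 pH pQ pX pY fX fY.
(* [c] starts the induction with [X <= c Y]; [b], with [Y <= b Q], sets the contraction rate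
   [1 - 1/b]. *)
have [c c1 hc] := psd_dominated pY (posdef_symm pX).
have [b b1 hb] := psd_dominated pQ (posdef_symm pY).
have b0 : 0 < b by apply: lt_trans b1.
pose r := 1 - b^-1.
have r0 : 0 <= r by rewrite subr_ge0 invf_le1 // ltW.
have r1 : `|r| < 1 by rewrite ger0_norm // /r ltrBlDr ltrDl invr_gt0.
have hk k : psd ((1 + (c - 1) * r ^+ k) *: Y - X).
  elim: k => [|k IH]; first by rewrite expr0 mulr1 [1 + _]addrC subrK.
  set e := (c - 1) * r ^+ k in IH.
  have e0 : 0 <= e by rewrite mulr_ge0 ?exprn_ge0 // subr_ge0 ltW.
  have := riccati_mono A Q l0 l1 pH pX IH; rewrite -fX => h1.
  have := @riccati_subhom _ _ A Q H lam Y (1 + e) l0 pH pY.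
  rewrite lerDl -fY => /(_ e0) h2.
  apply: psd_le_trans h1 _.
  apply: psd_le_trans h2 _.
  (* By [Y <= b Q], subtracting [e Q] from [(1 + e) Y] removes at least [(e / b) Y]. *)
  have -> : (1 + (c - 1) * r ^+ k.+1) *: Y - ((1 + e) *: Y - (1 + e - 1) *: Q) =
     (e / b) *: (b *: Q - Y).
    rewrite exprSr mulrA -/e /r scalerBr scalerA divfK ?gt_eqF //.
    by apply/matrixP => i j; rewrite !mxE; ring.
  by apply: psdZ hb; rewrite divr_ge0 // ltW.
split=> [|v]; first by rewrite /symmx linearB /= !posdef_symm.
rewrite -/(qform _ _) qformB subr_ge0.
have lim : (1 + (c - 1) * r ^+ k) * qform Y v @[k --> \oo] -->
    (1 + (c - 1) * 0) * qform Y v.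
  apply: cvgMr_tmp; apply: cvgD; first exact: cvg_cst.
  by apply: cvgMl_tmp; exact: cvg_expr.
move: lim; rewrite mulr0 addr0 mul1r => /cvgr_to_ge; apply.
apply: nearW => k; have [_ /(_ v)] := hk k.
by rewrite -/(qform _ _) qformB qformZ subr_ge0.
Qed.
End limits.

(** The iterates from [Y] decrease and stay above [Q], so their limit is positive definite.
    Subhomogeneity replaces continuity of the map in showing that the limit is fixed. *)
Lemma riccati_fix_exists (R : realType) n (A Q H : 'M[R]_n) lam Y :
  0 <= lam -> lam <= 1 -> psd H -> posdef Q -> posdef Y ->
  psd (Y - riccati A Q H lam Y) ->
  exists X, [/\ posdef X, X = riccati A Q H lam X & psd (Y - X)].
Proof.
move=> l0 l1 pH pQ pY hY.
set g := riccati A Q H lam.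
pose x k := iter k g Y.
have px k : posdef (x k).
  by elim: k => [//|k IH]; rewrite /x iterS; exact: riccati_posdef.
have dx k : psd (x k - x k.+1).
  by elim: k => [//|k IH]; exact: riccati_mono l0 l1 pH (px k.+1) IH.
have xQ k : psd (x k - Q).
  case: k => [|k]; last exact: riccati_ge.
  by apply: psd_le_trans _ hY; exact: riccati_ge.
have [L xL Lx] := psd_nonincreasing_limit (fun k => posdef_psd (px k)) dx.
have sQ := posdef_symm pQ.
have LQ : psd (L - Q).
  have sL : symmx L.
    have [] := xL 0%N; rewrite /symmx linearB /= (posdef_symm (px 0%N)).
    by move/addrI/oppr_inj.
  apply: (@psd_closed _ _ _ 1%:M) => [|e /Lx[k hk]].
    by rewrite /symmx linearB /= sL sQ.
  by have := psdD (xQ k) hk; rewrite addrC addrA subrK addrAC.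
have pL := posdef_le pQ LQ.
exists L; split=> //; last exact: xL 0%N.
have pg := riccati_posdef A l0 l1 pH pQ pL; rewrite -/g in pg.
have sD X : posdef X -> symmx (X - L) /\ symmx (L - X).
  by move=> /posdef_symm sX; rewrite /symmx !linearB /= sX (posdef_symm pL).
(* Since [I <= b L], an additive error [(e / b) I] becomes the relative error [e L], to which
   subhomogeneity applies. *)
have [b b1 hb] := psd_dominated pL (posdef_symm (posdef1 R n)).
have b0 : 0 < b by apply: lt_trans b1.
have near e : 0 < e -> exists k, psd ((1 + e) *: L - x k).
  move=> e0; have [k hk] := Lx _ (divr_gt0 e0 b0); exists k.
  apply: psd_le_trans hk _.
  have -> : (1 + e) *: L - (L + (e / b) *: 1%:M) = (e / b) *: (b *: L - 1%:M).
    rewrite scalerBr scalerA divfK ?gt_eqF // scalerDl scale1r opprD addrA.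
    by rewrite [L + _]addrC addrK.
  by apply: psdZ hb; rewrite divr_ge0 // ltW.
apply: psd_le_anti.
  (* Here [L <= x_(k+1) = g(x_k) <= g((1 + e) L) <= (1 + e) g(L)]. *)
  apply: (@psd_closed _ _ _ (g L)); first by case: (sD _ pg).
  move=> e e0; have [k hk] := near e e0.
  have h1 := riccati_mono A Q l0 l1 pH (px k) hk.
  have t1 : 1 <= 1 + e by rewrite lerDl ltW.
  have h2 := riccati_subhom A Q l0 pH pL t1.
  have h3 : psd ((1 + e) *: g L - ((1 + e) *: g L - (1 + e - 1) *: Q)).
    rewrite opprB addrC subrK addrC addrA addNr add0r.
    by apply: psdZ (posdef_psd pQ); exact: ltW.
  have := psd_le_trans (xL k.+1) (psd_le_trans (psd_le_trans h1 h2) h3).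
  by rewrite scalerDl scale1r addrAC.
(* Conversely [g(L) <= g(x_k) = x_(k+1) <= x_k <= L + e I]. *)
apply: (@psd_closed _ _ _ 1%:M); first by case: (sD _ pg).
move=> e /Lx[k hk]; rewrite addrAC.
apply: psd_le_trans _ (psd_le_trans (dx k) hk).
exact: riccati_mono.
Qed.

(* [(R + Z^-1)^-1], defined also when [Z] is singular. *)
Definition obs_gain (R : realType) m (Rm Z : 'M[R]_m) : 'M[R]_m :=
  Z *m invmx (1%:M + Rm *m Z).

(** * Woodbury's identity for the closed-loop map *)

Lemma unitmx_1D (R : realType) m (P Z : 'M[R]_m) :
  posdef P -> psd Z -> 1%:M + P *m Z \in unitmx.
Proof.
move=> pP pZ; have uP := posdef_unit pP.
have -> : 1%:M + P *m Z = P *m (invmx P + Z) by rewrite mulmxDr mulmxV.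
rewrite unitmx_mul uP; apply: posdef_unit.
exact/posdefD_psd/pZ/posdef_inv.
Qed.

(** Follows from [I + R Z = R (Z + R^-1)], and exhibits the gain as a Schur complement. *)
Lemma obs_gainE (R : realType) m (Rm Z : 'M[R]_m) : posdef Rm -> psd Z ->
  obs_gain Rm Z =
    invmx Rm - invmx Rm *m invmx (Z + invmx Rm) *m invmx Rm.
Proof.
move=> pR pZ; have uR := posdef_unit pR.
have u1 := unitmx_1D pR pZ.
have uS : Z + invmx Rm \in unitmx.
  by rewrite addrC; apply/posdef_unit/posdefD_psd/pZ/posdef_inv.
have e1 : 1%:M + Rm *m Z = Rm *m (Z + invmx Rm).
  by rewrite mulmxDr mulmxV // addrC.
apply: (can_inj (mulmxK u1)); rewrite /obs_gain mulmxKV // e1 mulmxBl.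
rewrite !mulmxA mulVmx // mul1mx mulmxKV // mulmxKV //.
by rewrite addrK.
Qed.

Lemma obs_gain_psd (R : realType) m (Rm Z : 'M[R]_m) :
  posdef Rm -> psd Z -> psd (obs_gain Rm Z).
Proof.
move=> pR pZ; rewrite obs_gainE //.
have pI := posdef_inv pR.
have sI : (invmx Rm)^T = invmx Rm by case: pI.
have pS : posdef (Z + invmx Rm) by rewrite addrC; exact: posdefD_psd.
rewrite -[X in _ *m X]sI; apply/psd_schur => //; rewrite sI.
(* The block matrix is the diagonal of 0 and [Z] plus a congruence image of [R^-1]. *)
have -> : block_mx (invmx Rm) (invmx Rm) (invmx Rm) (Z + invmx Rm) =
  block_mx 0 0 0 Z + col_mx 1%:M 1%:M *m invmx Rm *m (col_mx 1%:M 1%:M)^T.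
  rewrite tr_col_mx trmx1 mul_col_mx mul1mx mul_col_row mulmx1 add_block_mx.
  by rewrite !add0r.
by apply: psdD; [apply/psd_block_diag/psd0 | exact/psd_congr/posdef_psd].
Qed.

Lemma g_clZ_riccati (R : realType) n m (A : 'M[R]_n) (C : 'M[R]_(m, n))
    (Q : 'M[R]_n) (Rm Z : 'M[R]_m) lam X :
  posdef Rm -> psd Z -> posdef X ->
  g_clZ A C Q Rm lam Z X =
    riccati A Q (C^T *m obs_gain Rm Z *m C) lam X.
Proof.
move=> pR pZ pX.
set N := obs_gain Rm Z; set H := C^T *m N *m C.
set U := C *m X *m C^T.
have pU : posdef (U + Rm).
  by rewrite addrC; apply: posdefD_psd => //; exact/psd_congr/posdef_psd.
set E := Z *m invmx (1%:M + (U + Rm) *m Z).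
have uP := unitmx_1D pU pZ; have uR := unitmx_1D pR pZ.
(* A resolvent identity: for invertible [Z], [N] and [E] are the inverses of [R + Z^-1] and
   [U + R + Z^-1], which differ by [U]. *)
have NE : N = E + E *m U *m N.
  have NK : N *m (1%:M + Rm *m Z) = Z by exact: mulmxKV.
  have EK : E *m (1%:M + (U + Rm) *m Z) = Z by exact: mulmxKV.
  apply: (can_inj (mulmxK uR)).
  rewrite NK mulmxDl -(mulmxA _ N) NK -mulmxA -mulmxDr -addrA -mulmxDl.
  by rewrite [Rm + U]addrC EK.
have pH : psd H.
  have := psd_congr C^T (obs_gain_psd pR pZ); by rewrite trmxK.
have uX := posdef_unit pX.
have uS : invmx X + H \in unitmx by apply/posdef_unit/posdefD_psd/pH/posdef_inv.
have mE : mse H X = X - X *m C^T *m E *m C *m X.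
  apply: (can_inj (mulmxK uS)); rewrite mulVmx // mulmxBl !mulmxDr mulmxV //.
  rewrite mulmxK //.
  have -> : X *m C^T *m E *m C *m X *m H = X *m C^T *m (E *m U *m N) *m C.
    by rewrite /H /U !mulmxA.
  by rewrite -mulmxDl -mulmxDr -NE /H !mulmxA addrK.
rewrite /g_clZ -/U -/E /riccati mE mulmxBr mulmxBl !mulmxA.
by apply/matrixP => i j; rewrite !mxE; ring.
Qed.

(** * The linear matrix inequality as a Riccati inequality *)

(** Eliminate in turn the diagonal blocks [Z + R^-1], then [S] and [Q^-1] together, then [S + H].
    What is left is the Riccati inequality multiplied by [S] on both sides. *)
Lemma Psi_psd_iff (R : realType) n m (A : 'M[R]_n) (C : 'M[R]_(m, n))
    (Q : 'M[R]_n) (Rm Z : 'M[R]_m) lam S :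
  posdef Q -> posdef Rm -> 0 <= lam -> lam <= 1 -> psd Z -> posdef S ->
  psd (Psi A C Q Rm lam S Z) <->
  psd (invmx S - riccati A Q (C^T *m obs_gain Rm Z *m C) lam (invmx S)).
Proof.
move=> pQ pR l0 l1 pZ pS.
have pRi := posdef_inv pR; have sRi : (invmx Rm)^T = invmx Rm by case: pRi.
have sS : S^T = S by case: pS.
have uS := posdef_unit pS.
set N := obs_gain Rm Z; set H := C^T *m N *m C.
have pH : psd H.
  have := psd_congr C^T (obs_gain_psd pR pZ); by rewrite trmxK.
have pD : posdef (Z + invmx Rm) by rewrite addrC; exact: posdefD_psd.
set sl := Num.sqrt lam; set sl' := Num.sqrt (1 - lam).
have slE : sl * sl = lam by rewrite -expr2 sqr_sqrtr.
have slE' : sl' * sl' = 1 - lam by rewrite -expr2 sqr_sqrtr // subr_ge0.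
set B1 : 'M[R]_((n + n) + (n + n), m) :=
  col_mx (col_mx 0 (C^T *m invmx Rm)) (col_mx 0 0).
have B1T : B1^T = row_mx (row_mx 0 (invmx Rm *m C)) (row_mx 0 0).
  by rewrite /B1 !tr_col_mx !trmx0 trmx_mul trmxK sRi.
set B2 : 'M[R]_(n + n) := block_mx (sl' *: (S *m A)) S 0 0.
have B2T : B2^T = block_mx (sl' *: (A^T *m S)) 0 S 0.
  by rewrite /B2 tr_block_mx !trmx0 linearZ /= trmx_mul sS.
set D2 : 'M[R]_(n + n) := block_mx S 0 0 (invmx Q).
have pD2 : posdef D2 := posdef_block_diag pS (posdef_inv pQ).
set U := block_mx S (sl *: (S *m A)) (sl *: (A^T *m S)) (S + C^T *m invmx Rm *m C).
have PsiE : Psi A C Q Rm lam S Z =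
    block_mx (block_mx U B2 B2^T D2) B1 B1^T (Z + invmx Rm).
  by rewrite B1T B2T.
(* The first elimination turns [C^T R^-1 C] into [H], by the Schur form of the gain. *)
have E1 : block_mx U B2 B2^T D2 - B1 *m invmx (Z + invmx Rm) *m B1^T =
    block_mx (block_mx S (sl *: (S *m A)) (sl *: (A^T *m S)) (S + H)) B2 B2^T D2.
  have -> : B1 *m invmx (Z + invmx Rm) =
      col_mx (col_mx 0 (C^T *m invmx Rm *m invmx (Z + invmx Rm))) (col_mx 0 0).
    by rewrite /B1 !mul_col_mx !mul0mx.
  rewrite B1T !mul_col_row !mul0mx !mulmx0 !block_mx0.
  rewrite !(opp_block_mx, add_block_mx) !oppr0 !addr0.
  congr (block_mx (block_mx _ _ _ _) _ _ _).
  by rewrite -addrA /H /N obs_gainE // mulmxBr mulmxBl !mulmxA.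
have iD2 : invmx D2 = block_mx (invmx S) 0 0 Q.
  apply: (can_inj (mulKmx (posdef_unit pD2))).
  rewrite mulmxV ?posdef_unit // mulmx_block !(mul0mx, mulmx0, addr0, add0r).
  by rewrite mulmxV // mulVmx ?posdef_unit // -scalar_mx_block.
have E2 : block_mx S (sl *: (S *m A)) (sl *: (A^T *m S)) (S + H) -
    B2 *m invmx D2 *m B2^T =
    block_mx (S - (1 - lam) *: (S *m A *m invmx S *m A^T *m S) - S *m Q *m S)
      (sl *: (S *m A)) (sl *: (S *m A))^T (S + H).
  rewrite iD2 B2T /B2 !mulmx_block !(mul0mx, mulmx0, addr0, add0r).
  rewrite opp_block_mx add_block_mx !oppr0 !addr0.
  rewrite [(_ *: _)^T]linearZ /= trmx_mul sS opprD addrA -!(scalemxAl, scalemxAr) scalerA slE'.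
  by rewrite !mulmxA.
rewrite PsiE; apply: iff_trans (psd_schur _ _ pD) _; rewrite E1.
apply: iff_trans (psd_schur _ _ pD2) _; rewrite E2.
have pSH : posdef (S + H) by exact: posdefD_psd.
apply: iff_trans (psd_schur _ _ pSH) _.
apply: iff_trans (psd_congr_iff _ uS).
rewrite sS [(_ *: _)^T]linearZ /= trmx_mul sS -!(scalemxAl, scalemxAr) scalerA slE.
rewrite /riccati /mse invmxK.
have -> : S *m (invmx S - ((1 - lam) *: (A *m invmx S *m A^T) + Q +
    lam *: (A *m invmx (S + H) *m A^T))) *m S =
  S - (1 - lam) *: (S *m A *m invmx S *m A^T *m S) - S *m Q *m S -
   lam *: (S *m A *m invmx (S + H) *m (A^T *m S)).
  rewrite mulmxBr mulmxBl !(mulmxDr, mulmxDl) mulmxV // mul1mx.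
  by rewrite -!(scalemxAl, scalemxAr) !mulmxA !opprD !addrA.
by [].
Qed.

(** * Equivalence of the two problems *)

Theorem theorem4 (R : realType) (n m : nat)
    (A : 'M[R]_n) (C : 'M[R]_(m, n)) (Q : 'M[R]_n) (Rm : 'M[R]_m)
    (lam : R) (M : 'M[R]_n)
    (hQ : posdef Q) (hR : posdef Rm)
    (hlam0 : 0 < lam) (hlam1 : lam <= 1)
    (hlamrho : (1 - lam) * spectral_radius A ^+ 2 < 1)
    (hM : posdef M) :
  (* every feasible point of the original problem yields a point of calS
     with the same Z and no larger cost ... *)
  (forall T Z : 'M[R]_m, feasible_orig A C Q Rm lam M T Z ->
     exists X S : 'M[R]_n, in_calS A C Q Rm lam M X Z S /\
       f_obj C Rm X Z <= \tr (T *m Z))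
  /\
  (* ... and conversely; hence the two problems have the same optimal
     value and their optimal solutions correspond. *)
  (forall (X : 'M[R]_n) (Z : 'M[R]_m) (S : 'M[R]_n),
     in_calS A C Q Rm lam M X Z S ->
     exists T : 'M[R]_m, feasible_orig A C Q Rm lam M T Z /\
       \tr (T *m Z) <= f_obj C Rm X Z).
Proof.
have l0 := ltW hlam0.
have schur1 (X Y : 'M[R]_n) : posdef Y ->
    psd (block_mx X 1%:M 1%:M Y) <-> psd (X - invmx Y).
  by move=> pY; have := psd_schur X 1%:M pY; rewrite trmx1 mul1mx mulmx1.
have pH Z : psd Z -> psd (C^T *m obs_gain Rm Z *m C).
  move=> pZ; have := psd_congr C^T (obs_gain_psd hR pZ); by rewrite trmxK.
have trle (T T' Z : 'M[R]_m) : psd (T' - T) -> psd Z -> \tr (T *m Z) <= \tr (T' *m Z).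
  move=> hT pZ; rewrite -subr_ge0 -linearB /= -mulmxBl.
  exact: psd_trace_mul_ge0.
split=> [T Z [X [[pX [fX _]] [[_ [_ XM]] [[_ [_ XT]] pZ]]]]|X Z S [XS [SM [PS pZ]]]].
  (* The fixed point and its inverse make the first block inequality tight; the cost can only drop
     because [T >= C X C^T + R]. *)
  exists X, (invmx X); have pXi := posdef_inv pX.
  split; last exact: trle.
  split; first by apply/schur1 => //; rewrite invmxK subrr; exact: psd0.
  split; first by apply/schur1 => //; exact: psd_inv_anti.
  split=> //; apply/Psi_psd_iff => //.
  by rewrite invmxK -g_clZ_riccati // -fX subrr; exact: psd0.
have {}SM := (schur1 _ _ hM).1 SM.
(* [S >= M^-1 > 0], so [S] is invertible and the Schur reductions apply. *)
have pS := posdef_le (posdef_inv hM) SM.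
have {}XS := (schur1 _ _ pS).1 XS.
have pY := posdef_inv pS.
have YM : psd (M - invmx S).
  by rewrite -[M]invmxK; apply: psd_inv_anti => //; exact: posdef_inv.
have {}PS := (Psi_psd_iff A C hQ hR l0 hlam1 pZ pS).1 PS.
(* [S^-1] is a supersolution, hence dominates a fixed point [L]; then [L <= S^-1 <= M] gives
   feasibility and [L <= S^-1 <= X] the cost bound. *)
have [L [pL fL YL]] := riccati_fix_exists l0 hlam1 (pH _ pZ) hQ pY PS.
exists (C *m L *m C^T + Rm).
have sP W : posdef W -> symmx (C *m W *m C^T + Rm).
  move=> pW; apply: posdef_symm; rewrite addrC; apply: posdefD_psd => //.
  exact/psd_congr/posdef_psd.
split.
  exists L; split; last first.
    split; first by do 2 (split; first exact: posdef_symm); exact: psd_le_trans YM.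
    split=> //; do 2 (split; first exact: sP); rewrite subrr; exact: psd0.
  split=> //; split; first by rewrite g_clZ_riccati.
  move=> Y pdY; rewrite g_clZ_riccati // => fY.
  (* Uniqueness: any two positive definite fixed points dominate each other. *)
  apply: psd_le_anti.
    exact: riccati_fix_le l0 hlam1 (pH _ pZ) hQ pdY pL fY fL.
  exact: riccati_fix_le l0 hlam1 (pH _ pZ) hQ pL pdY fL fY.
apply: trle => //; rewrite opprD addrACA subrr addr0 -mulmxBl -mulmxBr.
apply: psd_congr; exact: psd_le_trans YL XS.
Qed.
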